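(* For every extended metric-topological measure space $\mathbb X=(X,\tau,\mathsf d,\mathfrak m)$ and every algebra $\mathscr A$ compatible with $\mathbb X$, the Sobolev space $H^{1,p}(\mathbb X,\mathscr A)$ is independent of the compatible algebra $\mathscr A$ and coincides with $H^{1,p}(\mathbb X)$.
   Context: $p\in(1,\infty)$ is fixed. An extended distance on $X$ is a symmetric map $\mathsf d:X\times X\to[0,\infty]$ satisfying the triangle inequality, with $\mathsf d(x,y)=0$ iff $x=y$. For $f:X\to\mathbb R$ and $A\subset X$, $\mathrm{Lip}(f,A,\mathsf d)=\inf\{L\in[0,\infty]:|f(y)-f(z)|\le L\,\mathsf d(y,z)\ \forall y,z\in A\}$. For a Hausdorff space $(X,\tau)$, $C_b(X)$ is the space of bounded $\tau$-continuous real functions, $\mathrm{Lip}_b(X,\tau,\mathsf d)=\{f\in C_b(X):\mathrm{Lip}(f,X,\mathsf d)<\infty\}$, and $\mathrm{Lip}_{b,1}(X,\tau,\mathsf d)$ is its subset of functions with $\mathrm{Lip}(f,X,\mathsf d)\le1$. $(X,\tau,\mathsf d)$ is an extended metric-topological (e.m.t.) space if $\tau$ is the initial topology generated by $\mathrm{Lip}_b(X,\tau,\mathsf d)$ and $\mathsf d(x,y)=\sup_{f\in\mathrm{Lip}_{b,1}(X,\tau,\mathsf d)}|f(x)-f(y)|$ for all $x,y\in X$. An extended metric-topological measure (e.m.t.m.) space is $\mathbb X=(X,\tau,\mathsf d,\mathfrak m)$ with $(X,\tau,\mathsf d)$ an e.m.t. space and $\mathfrak m$ a finite nonnegative Radon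 measure on $(X,\tau)$ (a Borel measure with $\mathfrak m(B)=\sup\{\mathfrak m(K):K\subset B\text{ compact}\}$). An algebra compatible with $\mathbb X$ is a unital subalgebra $\mathscr A\subset\mathrm{Lip}_b(X,\tau,\mathsf d)$ such that $\mathsf d(x,y)=\sup\{|f(x)-f(y)|:f\in\mathscr A,\ \mathrm{Lip}(f,X,\mathsf d)\le1\}$ for all $x,y\in X$. For $f\in\mathrm{Lip}_b(X,\tau,\mathsf d)$, $\mathrm{lip}f(x)=\inf\{\mathrm{Lip}(f,U,\mathsf d):U\text{ a }\tau\text{-neighborhood of }x\}$. For $f\in L^p(X,\mathfrak m)$, the Cheeger energy is $\mathsf{CE}_{p,\mathscr A}(f)=\inf\{\liminf_n\int_X(\mathrm{lip}f_n)^p\,d\mathfrak m:f_n\in\mathscr A,\ f_n\to f\text{ in }L^p(X,\mathfrak m)\}$, and $H^{1,p}(\mathbb X,\mathscr A)=\{f\in L^p(X,\mathfrak m):\mathsf{CE}_{p,\mathscr A}(f)<\infty\}$ is a Banach space with norm $(\mathsf{CE}_{p,\mathscr A}(f)+\|f\|_{L^p}^p)^{1/p}$. $H^{1,p}(\mathbb X)$ denotes $H^{1,p}(\mathbb X,\mathscr A)$ for $\mathscr A=\mathrm{Lip}_b(X,\tau,\mathsf d)$; coincidence of the spaces is understood with equality of Cheeger energies (hence of norms). *)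

(* Defs.v *)
From mathcomp Require Import all_boot all_order all_algebra.
From mathcomp Require Import all_classical all_reals all_analysis.

Set Implicit Arguments.
Unset Strict Implicit.
Unset Printing Implicit Defensive.

Import Order.TTheory GRing.Theory Num.Theory.
Import numFieldNormedType.Exports.

Local Open Scope classical_set_scope.
Local Open Scope ring_scope.

Section ExtendedMetricTopological.
Context {R : realType} {X : topologicalType}.
Implicit Types (d : X -> X -> \bar R) (f g : X -> R) (A : set (X -> R)).

Definition extended_distance d : Prop :=
  [/\ forall x y, (0 <= d x y)%E,
      forall x y, d x y = d y x,
      forall x y z, (d x z <= d x y + d y z)%E &
      forall x y, d x y = 0%E <-> x = y].

(* The library's convention 0 * +oo = 0 does not affect the infimum: when
   d y z = +oo every L > 0 is admissible for the pair (y, z). *)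
Definition Lip d f (U : set X) : \bar R :=
  ereal_inf [set L : \bar R | (0 <= L)%E /\
    forall y z, U y -> U z -> (`|f y - f z|%:E <= L * d y z)%E].

Definition Lipb d : set (X -> R) :=
  [set f | [/\ continuous f, bounded_fun f & (Lip d f [set: X] < +oo)%E]].

Definition recovers_distance d A : Prop :=
  forall x y, d x y =
    ereal_sup [set `|f x - f y|%:E | f in
                [set f | A f /\ (Lip d f [set: X] <= 1)%E]].

Definition initial_topology_of A : topologicalType :=
  sup_topology
    (fun f : {f : X -> R | A f} => Topological.on (initial_topology (sval f))).

Definition emt_space d : Prop :=
  [/\ hausdorff_space X, extended_distance d,
      @open X = @open (initial_topology_of (Lipb d)) &
      recovers_distance d (Lipb d)].

Definition unital_subalgebra A : Prop :=
  [/\ A (cst 1),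
      forall f g, A f -> A g -> A (f \+ g),
      forall f g, A f -> A g -> A (f \* g) &
      forall (c : R) f, A f -> A (fun x => c * f x)].

Definition compatible_algebra d A : Prop :=
  [/\ A `<=` Lipb d, unital_subalgebra A & recovers_distance d A].

Definition asymptotic_lip d f (x : X) : \bar R :=
  ereal_inf [set Lip d f U | U in nbhs x].

End ExtendedMetricTopological.

(* Measurable types of the library are pointed, hence ptopologicalType. *)
Notation borel X := (g_sigma_algebraType (@open X)).

Section Sobolev.
Context {R : realType} {X : ptopologicalType}.
Implicit Types (d : X -> X -> \bar R) (A : set (X -> R)).
Implicit Types m : {finite_measure set (borel X) -> \bar R}.

Definition radon m : Prop :=
  forall B : set (borel X), measurable B ->
    m B = ereal_sup [set m K | K in [set K : set X | compact K /\ K `<=` B]].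

Definition emtm_space d m : Prop := emt_space d /\ radon m.

(* CE depends on f only through its m-a.e. equivalence class. *)
Definition cheeger_energy d m (p : R) A (f : X -> R) : \bar R :=
  ereal_inf [set limn_einf (fun n => \int[m]_x (asymptotic_lip d (u n) x `^ p))%E
    | u in [set u : nat -> X -> R | (forall n, A (u n)) /\
        ('N[m]_(p%:E)[EFin \o (u n \- f)%R] @[n --> \oo] --> 0)%E]].

Definition sobolev d m (p : R) (p1 : (1 <= p%:E)%E) A : set (LspaceType m p1) :=
  [set f | (cheeger_energy d m p A f < +oo)%E].
Arguments sobolev : clear implicits.

Definition sobolev_norm d m (p : R) A (f : X -> R) : \bar R :=
  ((cheeger_energy d m p A f + 'N[m]_(p%:E)[EFin \o f] `^ p) `^ p^-1)%E.

Definition sobolev_coincide d m (p : R) (p1 : (1 <= p%:E)%E) A A' : Prop :=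
  [/\ sobolev d m p p1 A = sobolev d m p p1 A',
      forall f : LspaceType m p1,
        cheeger_energy d m p A f = cheeger_energy d m p A' f &
      forall f : LspaceType m p1, sobolev d m p p1 A f ->
        sobolev_norm d m p A f = sobolev_norm d m p A' f].

End Sobolev.
Arguments sobolev {R X} d m {p} p1 A _.

(* Main.v *)
Require Import Defs.
From mathcomp Require Import all_boot all_order all_algebra.
From mathcomp Require Import all_classical all_reals all_analysis.
From mathcomp Require Import measurable_realfun polyrcf ring lra.
Import Order.TTheory GRing.Theory Num.Theory.
Import numFieldNormedType.Exports.

(** Enlarging the algebra can only lower the Cheeger energy, so the theorem amounts
    to density in energy: every bounded Lipschitz f is approximated by members u
    of A with u close to f in L^p and the integral of lip(u)^p at most that of
    lip(f)^p up to a small error (energy_density).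

    The approximation is an explicit inf-convolution. The distance d is a supremum
    of continuous semidistances |g x - g y| with g in A and Lip g <= 1, hence on a
    compact K finitely many such g generate a continuous gauge D <= d that is as
    good as d for the Lipschitz inequalities of f, globally and locally, up to an
    arbitrarily small additive error (local_scale, finite_gauge). For a suitable
    convex function psi, consider
        h x = min (M, min over y in Y of f y + psi (D (x, y)))
    with Y a finite subset of K. At a nearly optimal y one has
    psi D <= f x - f y <= c D, where c is a Lipschitz constant of f near x, and
    the slope of h at x is about psi' D. A homogeneous psi of degree q bounds the
    slope by q c, so q has to be close to 1; a maximum of affine functions with
    slopes in arithmetic and breakpoints in geometric progression achieves the
    same effect (envelope_slope) and makes h a finite min-max of members of A.

    Minima and maxima are brought back into A by polynomials approximating the
    absolute value together with its derivative (smooth_abs). The resulting soft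
    extrema have at each point a local Lipschitz constant controlled by those of
    the nearly extremal functions only (soft_max, soft_min), which gives
    lip(u) <= lip(f) + error on K (envelope_approx).

    Pointwise bounds become uniform on K through a Lusin type choice of K
    (lusin_usc): lip(f) is upper semicontinuous, and on a compact set of almost
    full measure it lies just below a step function which is lower
    semicontinuous there. Off K the function u and its Lipschitz constant are
    bounded independently of K, so the contribution of the complement is
    negligible. *)

Local Open Scope classical_set_scope.
Local Open Scope ring_scope.

(** * Polynomials close to the absolute value *)

Definition antideriv {R : realType} (p : {poly R}) : {poly R} :=
  \poly_(i < (size p).+1) (p`_i.-1 / i%:R).

Lemma deriv_antideriv (R : realType) (p : {poly R}) : (antideriv p)^`() = p.
Proof.
apply/polyP => i; rewrite coef_deriv coef_poly ltnS /=.
case: ltnP => ip; last by rewrite mul0rn nth_default.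
by rewrite -(mulr_natr (_ / _)) mulfVK// pnatr_eq0.
Qed.

Lemma antideriv0 (R : realType) (p : {poly R}) : (antideriv p).[0] = 0.
Proof. by rewrite horner_coef0 coef_poly/= invr0 mulr0. Qed.

(** On the unit interval this cubic fixes 0, 1 and -1, repels from 0 and
    attracts to 1 and -1, so its iterates are polynomials converging to the sign
    function while staying bounded by 1. *)
Definition sharpen {R : realType} (s : R) : R := (3 * s - s ^+ 3) / 2.

Definition sign_poly (R : realType) (n : nat) : {poly R} :=
  iter n (fun p => 2^-1 *: (3 *: p - p ^+ 3)) 'X.

Lemma horner_sign_poly (R : realType) n (s : R) :
  (sign_poly R n).[s] = iter n sharpen s.
Proof.
elim: n => [|n IH]; first by rewrite hornerX.
by rewrite /= !hornerE IH mulrC.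
Qed.

Lemma sharpenN (R : realType) (s : R) : sharpen (- s) = - sharpen s.
Proof. by rewrite /sharpen; field. Qed.

Lemma iter_sharpenN (R : realType) n (s : R) :
  iter n sharpen (- s) = - iter n sharpen s.
Proof. by elim: n => //= n ->; rewrite sharpenN. Qed.

Lemma iter_sharpen_le1 (R : realType) n (s : R) :
  `|s| <= 1 -> `|iter n sharpen s| <= 1.
Proof.
move=> s1; elim: n => //= n; set r := iter _ _ _.
rewrite !ler_norml /sharpen => /andP[r1 r2].
have h1 : 0 <= (1 + r) ^+ 2 * (2 - r) by apply: mulr_ge0; [exact: sqr_ge0|lra].
have h2 : 0 <= (1 - r) ^+ 2 * (2 + r) by apply: mulr_ge0; [exact: sqr_ge0|lra].
by apply/andP; split; lra.
Qed.

(** The factorization 1 - sharpen s = (1 - s) (1 - (s + s^2) / 2) shows that each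
    step contracts the distance to the fixed point 1 by at least 1 - eta / 2. *)
Lemma iter_sharpen_ge (R : realType) n (eta s : R) : 0 < eta -> eta <= s <= 1 ->
  1 - (1 - eta / 2) ^+ n <= iter n sharpen s.
Proof.
move=> eta0 /andP[es s1].
have eta1 : eta <= 1 by lra.
suff : [/\ eta <= iter n sharpen s, iter n sharpen s <= 1 &
    1 - (1 - eta / 2) ^+ n <= iter n sharpen s] by case.
elim: n => [|n [IH1 IH2 IH3]]; first by rewrite /= expr0; split=> //; lra.
rewrite iterS; move: IH1 IH2 IH3; set r := iter _ _ _ => IH1 IH2 IH3.
set t := (1 - eta / 2) ^+ n in IH3 *.
have t0 : 0 <= t by apply: exprn_ge0; lra.
have gap : 1 - sharpen r = (1 - r) * (1 - (r + r ^+ 2) / 2).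
  by rewrite /sharpen; field.
have h1 : 0 <= 1 - (r + r ^+ 2) / 2 by nra.
have h2 : 1 - (r + r ^+ 2) / 2 <= 1 - eta / 2 by nra.
have r01 : 0 <= 1 - r by lra.
split.
- rewrite -subr_ge0; have -> : sharpen r - eta =
    (1 - eta) - (1 - r) * (1 - (r + r ^+ 2) / 2) by rewrite -gap; ring.
  nra.
- rewrite -subr_ge0 gap; exact: mulr_ge0.
- rewrite exprS -/t lerBlDr -lerBlDl gap mulrC; apply: ler_pM => //; lra.
Qed.

(** The antiderivative of a polynomial close to the sign function is close to the
    absolute value. Its difference quotients c are controlled by the mean value
    theorem; recording c for every pair of points, rather than the derivative,
    is what a chain rule for Lipschitz constants requires. *)
Lemma smooth_abs_unit (R : realType) (eta e : R) : 0 < eta -> 0 < e ->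
  exists P : {poly R}, forall r s, `|r| <= 1 -> `|s| <= 1 ->
  `|P.[r] - `|r| | <= 2 * eta + e /\
  exists c, [/\ P.[r] - P.[s] = c * (r - s), `|c| <= 1,
    eta <= r -> eta <= s -> 1 - e <= c &
    r <= - eta -> s <= - eta -> c <= - (1 - e)].
Proof.
move=> eta0 e0.
have [n hn] : exists n, forall s : R, eta <= s <= 1 -> 1 - e <= iter n sharpen s.
  have [eta1|eta1] := ltP 1 eta.
    by exists 0%N => s /andP[? ?]; lra.
  have : (fun n => (1 - eta / 2) ^+ n) @ \oo --> (0 : R).
    by apply: cvg_expr; rewrite ltr_norml; apply/andP; split; lra.
  move=> /cvgr0_norm_lt/(_ _ e0)[n _ /(_ n (leqnn n))] /= h.
  exists n => s hs; apply: le_trans (iter_sharpen_ge R n eta s eta0 hs).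
  by rewrite lerD2l lerN2 ltW//; apply: le_lt_trans h; exact: ler_norm.
pose P := antideriv (sign_poly R n).
have mvt r s : `|r| <= 1 -> `|s| <= 1 ->
  exists c, [/\ P.[r] - P.[s] = c * (r - s), `|c| <= 1,
    eta <= r -> eta <= s -> 1 - e <= c &
    r <= - eta -> s <= - eta -> c <= - (1 - e)].
  wlog sr : r s / s < r => [hw|].
    have [rs|sr|->] := ltgtP r s; [|exact: hw|].
      move=> h1 h2; have [c [h3 h4 h5 h6]] := hw _ _ rs h2 h1; exists c; split => //.
      - by rewrite -opprB h3; ring.
      - by move=> h7 h8; apply: h5.
      - by move=> h7 h8; apply: h6.
    move=> s1 _; exists (iter n sharpen s); split.
    - by rewrite !subrr mulr0.
    - exact: iter_sharpen_le1.
    - by move=> hs _; apply: hn; rewrite hs/= (le_trans (ler_norm _)).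
    - move=> hs _; rewrite lerNr -iter_sharpenN; apply: hn.
      by move: s1; rewrite ler_norml => /andP[]; lra.
  rewrite !ler_norml => /andP[r1 r2] /andP[s1 s2].
  have [x + hx] := poly_mvt P sr.
  rewrite in_itv/= => /andP[x1 x2].
  move: hx; rewrite deriv_antideriv horner_sign_poly => hx.
  exists (iter n sharpen x); split => //.
  - by apply: iter_sharpen_le1; rewrite ler_norml; lra.
  - by move=> h1 h2; apply: hn; lra.
  - by move=> h1 h2; rewrite lerNr -iter_sharpenN; apply: hn; lra.
exists P => r s hr hs; split; last exact: mvt.
have n0 : `|0 : R| <= 1 by rewrite normr0.
have P0 : P.[0] = 0 by exact: antideriv0.
have small x : `|x| <= 1 -> `|P.[x]| <= `|x|.
  move=> hx; have [c [+ c1 _ _]] := mvt _ _ hx n0.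
  by rewrite P0 !subr0 => ->; rewrite normrM ler_piMl.
have [re|re] := leP `|r| eta.
  have := small r hr; have := normr_ge0 r; rewrite !ler_norml; lra.
have e1 : `|eta| <= 1 by rewrite gtr0_norm// (le_trans (ltW re)).
have e1' : `|-eta| <= 1 by rewrite normrN.
have [r0|r0] := lerP 0 r.
- have [c [h1 h2 h3 _]] := mvt _ _ hr e1.
  have := small _ e1; have := small _ hr.
  move: re h2; rewrite (ger0_norm r0) (gtr0_norm eta0) !ler_norml => re /andP[h2 h2'].
  have := h3 (ltW re) (lexx _).
  have : r <= 1 by rewrite -(ger0_norm r0).
  have : P.[r] = P.[eta] + c * (r - eta) by rewrite -h1; ring.
  by move=> *; nra.
- have [c [h1 h2 _ h3]] := mvt _ _ hr e1'.
  have := small _ e1'; have := small _ hr.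
  move: re h2; rewrite (ltr0_norm r0) normrN (gtr0_norm eta0) !ler_norml => re /andP[h2 h2'].
  have : c <= - (1 - e) by apply: h3; lra.
  have : - r <= 1 by rewrite -(ltr0_norm r0).
  have : P.[r] = P.[-eta] + c * (r + eta) by rewrite -(opprK eta) -h1 opprK; ring.
  by move=> *; nra.
Qed.

Lemma smooth_abs (R : realType) (M eta e : R) : 0 < M -> 0 < eta -> 0 < e ->
  exists P : {poly R}, forall r s, `|r| <= M -> `|s| <= M ->
  `|P.[r] - `|r| | <= 3 * eta /\
  exists c, [/\ P.[r] - P.[s] = c * (r - s), `|c| <= 1,
    eta <= r -> eta <= s -> 1 - e <= c &
    r <= - eta -> s <= - eta -> c <= - (1 - e)].
Proof.
move=> M0 eta0 e0.
have e0' : 0 < Num.min e (eta / M) by rewrite lt_min e0 divr_gt0.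
have [P hP] := smooth_abs_unit R _ _ (divr_gt0 eta0 M0) e0'.
have M1 : M != 0 by lra.
exists (M *: (P \Po (M^-1 *: 'X))) => r s hr hs.
have scale x : `|x| <= M -> `|x / M| <= 1.
  by move=> hx; rewrite normrM normfV (gtr0_norm M0) ler_pdivrMr ?mul1r.
have ev x : (M *: (P \Po (M^-1 *: 'X))).[x] = M * P.[x / M].
  by rewrite hornerZ horner_comp hornerZ hornerX (mulrC _ x).
have [h1 [c [h2 h3 h4 h5]]] := hP _ _ (scale _ hr) (scale _ hs).
rewrite !ev; split.
  have -> : M * P.[r / M] - `|r| = M * (P.[r / M] - `|r / M|).
    by rewrite normrM normfV (gtr0_norm M0); field.
  rewrite normrM (gtr0_norm M0) -ler_pdivlMl//; apply: le_trans h1 _.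
  have : Num.min e (eta / M) <= eta / M by rewrite ge_min lexx orbT.
  by move=> h; rewrite mulrC mulrA mulrAC -mulrA; lra.
exists c; split => //.
- by rewrite -mulrBr h2; field.
- move=> h6 h7; apply: (@le_trans _ _ (1 - Num.min e (eta / M))).
    by rewrite lerD2l lerN2 ge_min lexx.
  by apply: h4; rewrite ler_pM2r// invr_gt0.
- move=> h6 h7; apply: (@le_trans _ _ (- (1 - Num.min e (eta / M)))).
    by apply: h5; rewrite -mulNr ler_pM2r// invr_gt0.
  by rewrite lerN2 lerD2l lerN2 ge_min lexx.
Qed.

(** * Local Lipschitz constants *)

(** The real-valued counterpart of a bound on Lip d f U: quantifying over pairs
    avoids manipulating an infimum of extended reals. *)
Definition lip_on {R : realType} {X : topologicalType} (d : X -> X -> \bar R)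
    (f : X -> R) (U : set X) (c : R) : Prop :=
  forall y z, U y -> U z -> (`|f y - f z|%:E <= c%:E * d y z)%E.

Definition lip_near {R : realType} {X : topologicalType} (d : X -> X -> \bar R)
    (f : X -> R) (x : X) (c : R) : Prop :=
  exists2 U, nbhs x U & lip_on d f U c.

Section LocalLipschitz.
Context {R : realType} {X : topologicalType} (d : X -> X -> \bar R).
Context (d_ge0 : forall x y, (0 <= d x y)%E).
Implicit Types (f g : X -> R) (U : set X) (c L : R).

Lemma lip_onW f U c c' : c <= c' -> lip_on d f U c -> lip_on d f U c'.
Proof.
move=> cc' h y z Uy Uz; apply: le_trans (h y z Uy Uz) _.
by rewrite lee_wpmul2r// lee_fin.
Qed.

Lemma lip_onS f U V c : U `<=` V -> lip_on d f V c -> lip_on d f U c.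
Proof. by move=> UV h y z Uy Uz; apply: h; apply: UV. Qed.

Lemma lip_nearW f x c c' : c <= c' -> lip_near d f x c -> lip_near d f x c'.
Proof. by move=> cc' [U xU h]; exists U => //; exact: lip_onW h. Qed.

Lemma lip_near_lip_on f x c : lip_on d f [set: X] c -> lip_near d f x c.
Proof. by exists setT => //; exact: filterT. Qed.

Lemma lip_on_lincomb f g h U a b c1 c2 :
  0 <= a -> 0 <= b -> 0 <= c1 -> 0 <= c2 ->
  (forall y z, U y -> U z ->
    `|h y - h z| <= a * `|f y - f z| + b * `|g y - g z|) ->
  lip_on d f U c1 -> lip_on d g U c2 -> lip_on d h U (a * c1 + b * c2).
Proof.
move=> a0 b0 c10 c20 hh hf hg y z Uy Uz.
apply: (@le_trans _ _ ((a * `|f y - f z| + b * `|g y - g z|)%:E)).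
  by rewrite lee_fin hh.
rewrite EFinD EFinM EFinM (EFinD (a * c1)) ge0_muleDl ?lee_fin ?mulr_ge0//.
by apply: leeD; rewrite EFinM -muleA; apply: lee_wpmul2l;
  rewrite ?lee_fin//; [exact: hf|exact: hg].
Qed.

Lemma lip_on_cst r U : lip_on d (cst r) U 0.
Proof. by move=> y z _ _; rewrite subrr normr0 mul0e. Qed.

Lemma Lip_le f U c : 0 <= c -> lip_on d f U c -> (Lip d f U <= c%:E)%E.
Proof. by move=> c0 h; apply: ereal_inf_lbound; split => //; rewrite lee_fin. Qed.

Lemma Lip_ge0 f U : (0 <= Lip d f U)%E.
Proof. by apply: le_ereal_inf_tmp => L []. Qed.

(** Positivity of c matters: at infinite distance the constant 0 forces equality
    of values, while the infimum Lip can be 0 without it. *)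
Lemma lip_on_Lip f U c : 0 < c -> (Lip d f U <= c%:E)%E -> lip_on d f U c.
Proof.
move=> c0 hc y z Uy Uz.
have := d_ge0 y z; case E : (d y z) => [D| |]// D0; last first.
  by rewrite gt0_muley ?lte_fin// leey.
rewrite lee_fin in D0.
rewrite -EFinM lee_fin; apply/ler_addgt0Pr => e e0.
have e1 : 0 < e / (D + 1) by rewrite divr_gt0// ltr_wpDl.
have : (Lip d f U < (c + e / (D + 1))%:E)%E.
  by apply: le_lt_trans hc _; rewrite lte_fin ltrDl.
move=> /ereal_inf_lt[L [L0 hL]] Lc.
have := hL _ _ Uy Uz; rewrite E => h.
have : (L * D%:E <= (c + e / (D + 1))%:E * D%:E)%E.
  by apply: lee_wpmul2r; [rewrite lee_fin|exact: ltW].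
move=> /(le_trans h); rewrite -EFinM lee_fin => /le_trans; apply.
rewrite mulrDl lerD2l -mulrA ler_piMr ?(ltW e0)// mulrC.
by rewrite ler_pdivrMr ?mul1r ?lerDl// ltr_wpDl.
Qed.

Lemma Lip_lty f U : (Lip d f U < +oo)%E -> exists2 L : R, 0 < L & lip_on d f U L.
Proof.
move=> h; have := Lip_ge0 f U => h0.
have hf : Lip d f U = (fine (Lip d f U))%:E by rewrite fineK// ge0_fin_numE.
have h1 : 0 <= fine (Lip d f U) by exact: fine_ge0.
exists (fine (Lip d f U) + 1); first by rewrite ltr_wpDl.
by apply: lip_on_Lip; rewrite ?ltr_wpDl// {1}hf lee_fin lerDl.
Qed.

Lemma asymptotic_lip_ge0 f x : (0 <= asymptotic_lip d f x)%E.
Proof. by apply: le_ereal_inf_tmp => _ [U _ <-]; exact: Lip_ge0. Qed.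

Lemma asymptotic_lip_le f x c : 0 <= c -> lip_near d f x c ->
  (asymptotic_lip d f x <= c%:E)%E.
Proof.
move=> c0 [U xU h]; apply: le_trans (Lip_le f U c c0 h).
by apply: ereal_inf_lbound; exists U.
Qed.

Lemma lip_near_asymptotic f x c : (asymptotic_lip d f x < c%:E)%E ->
  lip_near d f x c.
Proof.
move=> /ereal_inf_lt[_ [U xU <-]] h; exists U => //.
apply: lip_on_Lip; last exact: ltW.
by rewrite -lte_fin; apply: le_lt_trans h; exact: Lip_ge0.
Qed.

(** Upper semicontinuity: a neighbourhood realizing a bound at one point realizes
    it at all of its interior points. *)
Lemma open_asymptotic_lip_lt f (c : \bar R) :
  open [set x | (asymptotic_lip d f x < c)%E].
Proof.
rewrite openE => x /= /ereal_inf_lt[_ [U xU <-]] h.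
rewrite /interior; apply: filterS (nbhs_interior xU) => y yU /=.
by apply: le_lt_trans h; apply: ereal_inf_lbound; exists U.
Qed.

End LocalLipschitz.

(** * Soft extrema in an algebra of Lipschitz functions *)

Section SoftMaximum.
Context {R : realType} {X : topologicalType} (d : X -> X -> \bar R).
Context (d_ge0 : forall x y, (0 <= d x y)%E).
Context (A : set (X -> R)).
Context (algA : unital_subalgebra A).
Context (lipA : A `<=` Lipb d).

Lemma algebra_cst (c : R) : A (cst c).
Proof.
have [h1 _ _ hZ] := algA; have := hZ c _ h1.
by congr A; apply/funext => x /=; rewrite mulr1.
Qed.

Lemma algebraZ (c : R) f : A f -> A (fun x => c * f x).
Proof. by have [_ _ _ hZ] := algA; exact: hZ. Qed.

Lemma algebraN f : A f -> A (fun x => - f x).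
Proof.
move=> /(algebraZ (-1)); congr A; apply/funext => x; exact: mulN1r.
Qed.

Lemma algebraD f g : A f -> A g -> A (fun x => f x + g x).
Proof. by have [_ hD _ _] := algA; exact: hD. Qed.

Lemma algebraB f g : A f -> A g -> A (fun x => f x - g x).
Proof. by move=> Af Ag; apply: algebraD => //; exact: algebraN. Qed.

Lemma algebra_horner (P : {poly R}) f : A f -> A (fun x => P.[f x]).
Proof.
move=> Af; elim/poly_ind: P => [|P c IH].
  by have := algebra_cst 0; congr A; apply/funext => x /=; rewrite horner0.
have [_ _ hM _] := algA; have := algebraD _ _ (hM _ _ IH Af) (algebra_cst c).
by congr A; apply/funext => x /=; rewrite hornerMXaddC.
Qed.

Lemma algebra_bounded f : A f -> exists2 M : R, 0 < M & forall x, `|f x| <= M.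
Proof.
move=> /lipA[_ [M [_ hM]] _]; exists (`|M| + 1); first by rewrite ltr_wpDl.
move=> x; apply: (hM _ _ x I).
by rewrite (le_lt_trans (ler_norm _))// ltrDl.
Qed.

Lemma algebra_lip f : A f -> exists2 L : R, 0 < L & lip_on d f [set: X] L.
Proof. by move=> /lipA[_ _ hf]; exact: Lip_lty. Qed.

Lemma algebra_continuous f : A f -> continuous f.
Proof. by move=> /lipA[]. Qed.

(** A maximum leaves the algebra, so it is replaced by
    u = (u1 + u2) / 2 + P (u1 - u2) / 2 with P a polynomial close to the absolute
    value. Increments of u are combinations (1 + c) / 2 and (1 - c) / 2 of those
    of u1 and u2, with c close to 1 where u1 is clearly larger and close to -1
    where u2 is. Hence only the functions that nearly attain the maximum at a
    point contribute to the local Lipschitz constant there. *)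
Lemma soft_max2 u1 u2 (theta : R) : A u1 -> A u2 -> 0 < theta ->
  exists2 u, A u & forall x,
    [/\ u1 x <= u x + theta, u2 x <= u x + theta,
        u x <= u1 x + theta \/ u x <= u2 x + theta &
        forall c, 0 <= c ->
          (u x - theta <= u1 x -> lip_near d u1 x c) ->
          (u x - theta <= u2 x -> lip_near d u2 x c) ->
          lip_near d u x (c + theta)].
Proof.
move=> A1 A2 th0.
have [L1 L10 hL1] := algebra_lip _ A1.
have [L2 L20 hL2] := algebra_lip _ A2.
have Aw := algebraB _ _ A1 A2.
have [M M0 hM] := algebra_bounded _ Aw.
(* e makes the contribution of the dominated function at most theta. *)
set e := theta / (L1 + L2).
have e0 : 0 < e by rewrite divr_gt0// addr_gt0.
have eL : e * L1 + e * L2 = theta by rewrite -mulrDr /e mulfVK// gt_eqF// addr_gt0.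
have eL1 : 0 < e * L1 by rewrite mulr_gt0.
have eL2 : 0 < e * L2 by rewrite mulr_gt0.
have th8 : 0 < theta / 8 by rewrite divr_gt0.
have [P hP] := smooth_abs R M (theta / 8) e M0 th8 e0.
pose w x := u1 x - u2 x.
pose u x := 2^-1 * (u1 x + u2 x) + 2^-1 * P.[w x].
have uE y z : exists c, [/\ u y - u z = (1 + c) / 2 * (u1 y - u1 z) +
    (1 - c) / 2 * (u2 y - u2 z), `|c| <= 1,
    theta / 8 <= w y -> theta / 8 <= w z -> 1 - e <= c &
    w y <= - (theta / 8) -> w z <= - (theta / 8) -> c <= - (1 - e)].
  have [_ [c [h1 h2 h3 h4]]] := hP _ _ (hM y) (hM z).
  exists c; split => //.
  transitivity (2^-1 * (u1 y + u2 y - (u1 z + u2 z)) + 2^-1 * (P.[w y] - P.[w z])).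
    by rewrite /u; field.
  by rewrite h1 /w; field.
have cw : continuous w by exact: (algebra_continuous _ Aw).
exists u.
  apply: algebraD; apply: algebraZ; first exact: algebraD.
  exact: (algebra_horner P _ Aw).
move=> x.
have [+ _] := hP _ _ (hM x) (hM x).
rewrite ler_norml -/(w x) => /andP[p1 p2].
have wE : w x = u1 x - u2 x by [].
have ux : u x = 2^-1 * (u1 x + u2 x) + 2^-1 * P.[w x] by [].
have w1 : w x <= `|w x| by exact: ler_norm.
have w2 : - w x <= `|w x| by rewrite -normrN; exact: ler_norm.
have w3 : `|w x| = w x \/ `|w x| = - w x.
  by have [h|h] := leP 0 (w x); [left; rewrite ger0_norm|right; rewrite ltr0_norm].
split.
- lra.
- lra.
- by case: w3 => w3; [left|right]; lra.
move=> c c0 a1 a2.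
have [wp|wp] := ltrP (theta / 8) (w x).
  have [U xU hU] : lip_near d u1 x c by apply: a1; case: w3; lra.
  pose V := [set y | theta / 8 < w y].
  have xV : nbhs x V by exact: (cw x [set r | theta / 8 < r] (lt_nbhsr wp)).
  exists (U `&` V); first exact: filterI.
  apply: (@lip_onW _ _ d d_ge0 _ _ (1 * c + e / 2 * L2)); first by lra.
  apply: (lip_on_lincomb d u1 u2) => //; try lra.
  - move=> y z [_ yV] [_ zV].
    have [c' [-> c1 c2 _]] := uE y z.
    have {}c2 : 1 - e <= c' by apply: c2; exact: ltW.
    move: c1; rewrite ler_norml => /andP[c3 c4].
    apply: le_trans (ler_normD _ _) _.
    rewrite (normrM _ (u1 y - u1 z)) (normrM _ (u2 y - u2 z)).
    apply: lerD; apply: ler_wpM2r => //; rewrite ger0_norm; lra.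
  - by apply: lip_onS hU => ? [].
  - exact: lip_onS hL2.
have [wn|wn] := ltrP (w x) (- (theta / 8)).
  have [U xU hU] : lip_near d u2 x c by apply: a2; case: w3; lra.
  pose V := [set y | w y < - (theta / 8)].
  have xV : nbhs x V by exact: (cw x [set r | r < - (theta / 8)] (lt_nbhsl wn)).
  exists (U `&` V); first exact: filterI.
  apply: (@lip_onW _ _ d d_ge0 _ _ (e / 2 * L1 + 1 * c)); first by lra.
  apply: (lip_on_lincomb d u1 u2) => //; try lra.
  - move=> y z [_ yV] [_ zV].
    have [c' [-> c1 _ c2]] := uE y z.
    have {}c2 : c' <= - (1 - e) by apply: c2; exact: ltW.
    move: c1; rewrite ler_norml => /andP[c3 c4].
    apply: le_trans (ler_normD _ _) _.
    rewrite (normrM _ (u1 y - u1 z)) (normrM _ (u2 y - u2 z)).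
    apply: lerD; apply: ler_wpM2r => //; rewrite ger0_norm; lra.
  - exact: lip_onS hL1.
  - by apply: lip_onS hU => ? [].
have [U xU hU] : lip_near d u1 x c by apply: a1; case: w3; lra.
have [V xV hV] : lip_near d u2 x c by apply: a2; case: w3; lra.
(* Both functions are active: every increment is a convex combination. *)
exists (U `&` V); first exact: filterI.
move=> y z [Uy Vy] [Uz Vz].
have [c' [uyz c1 _ _]] := uE y z.
move: c1; rewrite ler_norml => /andP[c3 c4].
have hd := d_ge0 y z.
apply: (@le_trans _ _ (c%:E * d y z)%E); last first.
  by apply: lee_wpmul2r => //; rewrite lee_fin; lra.
apply: (@le_trans _ _ (Num.max `|u1 y - u1 z| `|u2 y - u2 z|)%:E); last first.
  rewrite /Num.max; case: ifP => _; [exact: hV|exact: hU].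
have m1 : `|u1 y - u1 z| <= Num.max `|u1 y - u1 z| `|u2 y - u2 z|.
  by rewrite le_max lexx.
have m2 : `|u2 y - u2 z| <= Num.max `|u1 y - u1 z| `|u2 y - u2 z|.
  by rewrite le_max lexx orbT.
rewrite lee_fin uyz; apply: le_trans (ler_normD _ _) _.
    rewrite (normrM _ (u1 y - u1 z)) (normrM _ (u2 y - u2 z)).
rewrite (@ger0_norm _ ((1 + c') / 2)) 1?(@ger0_norm _ ((1 - c') / 2)); [|lra..].
nra.
Qed.

Lemma soft_max (us : seq (X -> R)) (theta : R) :
  0 < theta -> us <> [::] -> (forall v, v \in us -> A v) ->
  exists2 u, A u & forall x,
    [/\ forall v, v \in us -> v x <= u x + theta,
        exists2 v, v \in us & u x <= v x + theta &
        forall c, 0 <= c ->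
          (forall v, v \in us -> u x - theta <= v x -> lip_near d v x c) ->
          lip_near d u x (c + theta)].
Proof.
elim: us theta => // v0 us IH theta th0 _ Aus.
have A0 : A v0 by apply: Aus; rewrite mem_head.
have [->|/eqP us0] := eqVneq us [::].
  exists v0 => // x; split.
  - by move=> v; rewrite inE => /eqP ->; rewrite lerDl ltW.
  - by exists v0; rewrite ?mem_head// lerDl ltW.
  - move=> c c0 h; apply: (@lip_nearW _ _ d d_ge0 _ _ c); first by rewrite lerDl ltW.
    by apply: h; rewrite ?mem_head// gerBl ltW.
have th4 : 0 < theta / 4 by rewrite divr_gt0.
have [|u' Au' hu'] := IH _ th4 us0.
  by move=> v vus; apply: Aus; rewrite inE vus orbT.
have [u Au hu] := soft_max2 v0 u' (theta / 4) A0 Au' th4.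
exists u => // x.
have [a1 a2 a3] := hu x; have [b1 b2 b3] := hu' x => a4; split.
- move=> v; rewrite inE => /orP[/eqP ->|/b1]; lra.
- case: a3 => a3; first by exists v0; rewrite ?mem_head//; lra.
  by case: b2 => v vus hv; exists v; rewrite ?inE ?vus ?orbT//; lra.
move=> c c0 h.
apply: (@lip_nearW _ _ d d_ge0 _ _ ((c + theta / 4) + theta / 4)); first by lra.
apply: a4; first by lra.
- move=> hv0; apply: (@lip_nearW _ _ d d_ge0 _ _ c); first by lra.
  by apply: h; rewrite ?mem_head//; lra.
- move=> hu'u; apply: b3 => // v vus hv.
  by apply: h; rewrite ?inE ?vus ?orbT//; lra.
Qed.

Lemma lip_nearN f x c : lip_near d f x c -> lip_near d (fun x => - f x) x c.
Proof.
by move=> [U xU h]; exists U => // y z Uy Uz; rewrite -opprD normrN; exact: h.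
Qed.

Lemma soft_min (us : seq (X -> R)) (theta : R) :
  0 < theta -> us <> [::] -> (forall v, v \in us -> A v) ->
  exists2 u, A u & forall x,
    [/\ forall v, v \in us -> u x <= v x + theta,
        exists2 v, v \in us & v x <= u x + theta &
        forall c, 0 <= c ->
          (forall v, v \in us -> v x <= u x + theta -> lip_near d v x c) ->
          lip_near d u x (c + theta)].
Proof.
move=> th0 us0 Aus.
pose opp (v : X -> R) := fun x => - v x.
have [||u Au hu] := soft_max (map opp us) theta th0.
- by move: us0; case: (us).
- by move=> v /mapP[v' /Aus Av' ->]; exact: algebraN.
exists (opp u); first exact: algebraN.
move=> x; have [h1 h2 h3] := hu x; split.
- by move=> v vus; have := h1 _ (map_f opp vus); rewrite /opp; lra.
- have [_ /mapP[v vus ->]] := h2; rewrite /opp => h4.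
  by exists v => //; lra.
- move=> c c0 h; apply: lip_nearN; apply: h3 => // _ /mapP[v vus ->] hv.
  by apply: lip_nearN; apply: h => //; move: hv; rewrite /opp; lra.
Qed.

End SoftMaximum.

(** * Inf-convolution on a compact set *)

(** Finite subcovers, phrased as a finite choice of witnesses that serve all points
    of a compact set. *)
Lemma compact_finite_choice (T : topologicalType) (E : choiceType)
    (C : set T) (D : set E) (Q : E -> T -> Prop) : compact C ->
  (forall z, C z -> exists2 e, D e & \forall z' \near z, C z' -> Q e z') ->
  exists2 s : seq E, (forall e, e \in s -> D e) &
    forall z, C z -> exists2 e, e \in s & Q e z.
Proof.
move=> /compact_near_coveringP Ccpt loc.
(* Finite lists ordered by inclusion. *)
pose F : set_system (seq E) := filter_from setT
  (fun s : seq E => [set s' : seq E | {subset s <= s'}]).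
have FF : Filter F.
  apply: filter_from_filter; first by exists [::].
  move=> s1 s2 _ _; exists (s1 ++ s2) => // s h; split => e es; apply: h;
  by rewrite mem_cat es ?orbT.
have [] := Ccpt _ F (fun s z => C z -> exists2 e, e \in s & D e /\ Q e z) FF.
  move=> z /loc[e De zQ].
  exists ([set z' | C z' -> Q e z'], [set s : seq E | e \in s]) => /=.
    split => //; exists [:: e] => // s; apply; exact: mem_head.
  by move=> [z' s] /= [h es] Cz'; exists e => //; split => //; exact: h.
move=> s _ hs; exists [seq e <- s | `[< D e >]].
  by move=> e; rewrite mem_filter => /andP[/asboolP].
move=> z Cz; have [//|//|e es [De Qe]] := hs s _ z Cz.
by exists e => //; rewrite mem_filter es andbT; exact/asboolP.
Qed.

Lemma near_all_seq (T : Type) (E : eqType) (F : set_system T) (FF : Filter F)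
    (s : seq E) (P : E -> T -> Prop) :
  (forall e, e \in s -> \forall x \near F, P e x) ->
  \forall x \near F, forall e, e \in s -> P e x.
Proof.
elim: s => [|e s IH] h; first exact: nearW.
have h1 := h e (mem_head _ _).
have h2 : \forall x \near F, forall e, e \in s -> P e x.
  by apply: IH => e' es; apply: h; rewrite inE es orbT.
near=> x => e'; rewrite inE => /orP[/eqP ->|]; first by near: x.
by move: e'; near: x.
Unshelve. all: by end_near. Qed.

Lemma seq_argmax (R : realType) (E : eqType) (s : seq E) (h : E -> R) :
  s <> [::] -> exists2 e, e \in s & forall e', e' \in s -> h e' <= h e.
Proof.
elim: s => // e0 s IH _.
have [->|/eqP/IH[e es he]] := eqVneq s [::].
  by exists e0; rewrite ?mem_head// => e'; rewrite inE => /eqP ->.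
have [h0|h0] := leP (h e0) (h e).
  exists e; first by rewrite inE es orbT.
  by move=> e'; rewrite inE => /orP[/eqP ->//|/he].
exists e0; first exact: mem_head.
by move=> e'; rewrite inE => /orP[/eqP ->//|/he h1]; apply: le_trans h1 (ltW h0).
Qed.

Lemma near_continuous_gt (R : realType) (T : topologicalType) (h : T -> R) x c :
  {for x, continuous h} -> c < h x -> \forall x' \near x, c < h x'.
Proof. by move=> hc hx; exact: (hc [set r | c < r] (lt_nbhsr hx)). Qed.

Section Construction.
Context {R : realType} {X : topologicalType} (d : X -> X -> \bar R).
Context (d_ext : extended_distance d).
Context (A : set (X -> R)).
Context (algA : unital_subalgebra A).
Context (lipA : A `<=` Lipb d).
Context (recA : recovers_distance d A).

Let d_ge0 x y : (0 <= d x y)%E.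
Proof. by have [] := d_ext. Qed.

Let A1 : set (X -> R) := [set g | A g /\ lip_on d g [set: X] 1].

Lemma recovers_gap x y (c : R) : (c%:E < d x y)%E -> exists2 g, A1 g & c < g x - g y.
Proof.
rewrite (recA x y) => /ereal_sup_gt[_ [g [Ag g1] <-]].
rewrite lte_fin ltr_normr => /orP[h|h].
  by exists g => //; split => //; exact: lip_on_Lip.
exists (fun x => - g x); last by lra.
split; first exact: (algebraN A algA).
have h1 : lip_on d g [set: X] 1 by exact: lip_on_Lip.
by move=> a b _ _; rewrite -opprD normrN; exact: h1.
Qed.

Lemma A1_continuous g : A1 g -> continuous g.
Proof. by move=> [/lipA[]]. Qed.

Lemma continuous_diff (g : X -> R) : continuous g ->
  continuous (fun z : X * X => g z.1 - g z.2).
Proof.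
move=> gc z; apply: cvgB.
- exact: (continuous_comp (@cvg_fst _ _ _ _ _) (gc z.1)).
- exact: (continuous_comp (@cvg_snd _ _ _ _ _) (gc z.2)).
Qed.

Context (f : X -> R) (L M eps : R) (K : set X) (sigma : X -> R).
Context (fc : continuous f) (fM : forall x, `|f x| <= M).
Context (L0 : 0 < L) (fL : lip_on d f [set: X] L) (eps0 : 0 < eps).
Context (Kcpt : compact K).
Context (sigma0 : forall x, K x -> 0 < sigma x).
Context (sigma_lsc :
  forall x, K x -> \forall x' \near x, K x' -> sigma x <= sigma x').
Context (f_sigma : forall x, K x -> lip_near d f x (sigma x)).

(** Off the diagonal the algebra separates points, and near the diagonal f has the
    local Lipschitz constant sigma; compactness of K x K makes the threshold r
    between the two regimes uniform. *)
Lemma local_scale : exists2 r : R, 0 < r & forall x y, K x -> K y ->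
  (exists2 g, A1 g & r <= g x - g y) \/
  (`|f x - f y|%:E <= (sigma x)%:E * d x y)%E.
Proof.
have /compact_near_coveringP KK := compact_setX Kcpt Kcpt.
pose P (r : R) (z : X * X) := K z.1 -> K z.2 ->
  (exists2 g, A1 g & r <= g z.1 - g z.2) \/
  (`|f z.1 - f z.2|%:E <= (sigma z.1)%:E * d z.1 z.2)%E.
have : \forall r \near 0^'+, K `*` K `<=` P r.
  apply: KK => -[x y] [/= Kx Ky].
  have [<-|xy] := pselect (x = y).
    have [U xU hU] := f_sigma _ Kx.
    have hs := sigma_lsc _ Kx.
    exists ([set z : X * X | (U z.1 /\ (K z.1 -> sigma x <= sigma z.1)) /\ U z.2],
      setT) => /=.
      split; last exact: filterT.
      exists (U `&` [set z | K z -> sigma x <= sigma z], U) => /=.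
        by split => //; exact: filterI.
      by move=> [a b] [[]].
    move=> [[a b] r] [/= [[Ua sa] Ub] _] /= Ka Kb; right.
    apply: le_trans (hU _ _ Ua Ub) _.
    by apply: lee_wpmul2r => //; rewrite lee_fin; exact: sa.
  have : (0%:E < d x y)%E.
    rewrite lt_neqAle d_ge0 andbT eq_sym; apply/eqP => dxy.
    by apply: xy; have [_ _ _ h] := d_ext; apply/h.
  move=> /recovers_gap[g Ag g0].
  exists ([set z : X * X | (g x - g y) / 2 < g z.1 - g z.2],
      [set r | r < (g x - g y) / 2]) => /=.
    split; last by apply: nbhs_right_lt; rewrite divr_gt0.
    apply: (near_continuous_gt R _ (fun z : X * X => g z.1 - g z.2)) => /=; last by lra.
    exact/continuous_diff/A1_continuous.
  move=> [[a b] r] [/= h1 h2] Ka Kb; left; exists g => //=.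
  by apply: ltW; exact: lt_trans h1.
move=> h; have [r [r0 hr]] : exists r : R, 0 < r /\ K `*` K `<=` P r.
  near (0 : R)^'+ => r; exists r; split; first by [].
  by near: r.
by exists r => // x y Kx Ky; apply: (hr (x, y)).
Unshelve. all: by end_near. Qed.

(** The distance is only a supremum of continuous semidistances and need not be
    continuous, but on the compact K finitely many 1-Lipschitz members of the
    algebra already witness, up to theta, the global and the local Lipschitz
    inequalities of f. They generate a continuous substitute for the distance. *)
Lemma finite_gauge (r theta : R) : 0 < r -> 0 < theta ->
  (forall x y, K x -> K y ->
    (exists2 g, A1 g & r <= g x - g y) \/
    (`|f x - f y|%:E <= (sigma x)%:E * d x y)%E) ->
  exists F : seq (X -> R), [/\ cst 0 \in F, forall g, g \in F -> A1 g,
    forall x y, K x -> K y -> exists2 g, g \in F &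
      f x - f y <= L * (g x - g y) + theta &
    forall x y, K x -> K y -> exists2 g, g \in F &
      r / 2 <= g x - g y \/ f x - f y <= sigma x * Num.max 0 (g x - g y) + theta].
Proof.
move=> r0 theta0 hr.
have KK := compact_setX Kcpt Kcpt.
have gap s x y : 0 < s -> (`|f x - f y|%:E <= s%:E * d x y)%E ->
    exists2 g, A1 g & \forall z \near (x, y),
      f z.1 - f z.2 < s * (g z.1 - g z.2) + theta.
  move=> s0 hs.
  have : (((f x - f y - theta) / s)%:E < d x y)%E.
    move: hs; have := d_ge0 x y; case: (d x y) => [D| |]// _; last by rewrite ltry.
    rewrite -EFinM lee_fin lte_fin ltr_pdivrMr// (mulrC D).
    by have := ler_norm (f x - f y); lra.
  move=> /recovers_gap[g Ag hg]; exists g => //.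
  suff : \forall z \near (x, y), - theta < s * (g z.1 - g z.2) - (f z.1 - f z.2).
    by apply: filterS => z; lra.
  apply: near_continuous_gt => /=.
    apply: continuousB; last exact/continuous_diff.
    apply: continuousM; first exact: cst_continuous.
    exact/continuous_diff/A1_continuous.
  by move: hg; rewrite ltr_pdivrMr// mulrC; lra.
have [F1 F1A hF1] : exists2 s : seq (X -> R), (forall e, e \in s -> A1 e) &
    forall z, (K `*` K) z -> exists2 g, g \in s &
      f z.1 - f z.2 <= L * (g z.1 - g z.2) + theta.
  apply: compact_finite_choice => // -[x y] [/= Kx Ky].
  have [g Ag hg] := gap L x y L0 (fL x y I I).
  by exists g => //; apply: filterS hg => z /ltW.
have [F2 F2A hF2] : exists2 s : seq (X -> R), (forall e, e \in s -> A1 e) &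
    forall z, (K `*` K) z -> exists2 g, g \in s &
      r / 2 <= g z.1 - g z.2 \/
      f z.1 - f z.2 <= sigma z.1 * Num.max 0 (g z.1 - g z.2) + theta.
  apply: compact_finite_choice => // -[x y] [/= Kx Ky].
  have [[g Ag hg]|hs] := hr x y Kx Ky.
    exists g => //.
    have : \forall z \near (x, y), r / 2 < g z.1 - g z.2.
      apply: near_continuous_gt => /=; last by lra.
      exact/continuous_diff/A1_continuous.
    by apply: filterS => z h _; left; exact: ltW.
  have [g Ag hg] := gap _ x y (sigma0 _ Kx) hs.
  exists g => //.
  have hl : \forall z \near (x, y), K z.1 -> sigma x <= sigma z.1.
    exact: (cvg_fst (sigma_lsc _ Kx)).
  apply: filterS2 hg hl => -[a b] /= h1 h2 [Ka Kb]; right.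
  apply: ltW; apply: lt_le_trans h1 _; rewrite lerD2r.
  apply: (@le_trans _ _ (sigma x * Num.max 0 (g a - g b))).
    by rewrite ler_pM2l ?sigma0// le_max lexx orbT.
  by apply: ler_wpM2r; [rewrite le_max lexx|exact: h2].
exists (cst 0 :: F1 ++ F2); split.
- exact: mem_head.
- move=> g; rewrite inE mem_cat => /orP[/eqP ->|/orP[/F1A|/F2A]//].
  split; first exact: algebra_cst.
  by apply: (@lip_onW _ _ d d_ge0 _ _ 0) => //; exact: lip_on_cst.
- move=> x y Kx Ky; have [//|g gF h] := hF1 (x, y).
  by exists g => //; rewrite inE mem_cat gF orbT.
- move=> x y Kx Ky; have [//|g gF h] := hF2 (x, y).
  by exists g => //; rewrite inE mem_cat gF !orbT.
Qed.


(** The choice of the convex function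
    psi D = max over j <= N of eps (j D - t 2^j)
    in the inf-convolution: it satisfies psi' D <= psi D / D + 2 eps at scales
    where its k-th affine piece is active, because the breakpoints grow
    geometrically. Indeed, fx is the value of f at x, fy its value at a nearly
    optimal point y at gauge distance D, and v is close to fy + psi D. Optimality
    gives psi D <= fx - fy, which is at most sg D for D small; activity of the k-th
    piece gives D >= t 2^(k-1); together these bound its slope eps k by
    sg + 3 eps. A quadratic psi would lose a factor 2 here. *)
Lemma envelope_slope (k N : nat) (t theta D T2 fx fy sg v r g : R) :
  0 < t -> 0 < theta -> theta <= eps * t / 16 -> t <= T2 -> T2 = t * 2 ^+ N ->
  T2 <= r / 8 -> L + eps <= eps * N%:R -> 0 <= D -> 0 < sg -> (k <= N)%N ->
  g <= D ->
  fx - fy <= L * D + theta ->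
  (D < r / 2 -> fx - fy <= sg * D + theta) ->
  v <= fx + 3 * theta ->
  (forall j, (j <= N)%N -> fy - eps * (t * 2 ^+ j) + eps * j%:R * D <= v + theta) ->
  v - theta <= fy - eps * (t * 2 ^+ k) + eps * k%:R * g ->
  eps * k%:R <= sg + 3 * eps.
Proof.
move=> t0 th0 th1 tT T2E Tr NL D0 sg0 kN gD h1 h2 h3 h4 h5.
have et : 0 < eps * t by rewrite mulr_gt0.
have e5 : eps * D <= eps * T2 + 5 * theta.
  have := h4 N (leqnn N); rewrite -T2E => h6.
  have : (L + eps) * D <= eps * N%:R * D by exact: ler_wpM2r.
  by rewrite mulrDl; lra.
have Dr : D < r / 2.
  rewrite -(ltr_pM2l eps0); apply: le_lt_trans e5 _.
  have : eps * t <= eps * T2 by rewrite ler_pM2l.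
  have : eps * T2 <= eps * (r / 8) by rewrite ler_pM2l.
  lra.
have {}h2 := h2 Dr.
case: k => [|k] in kN h5 *; first by rewrite mulr0 addr_ge0 ?mulr_ge0// ltW.
have := h4 k (ltnW kN).
rewrite exprS in h5.
rewrite -(natr1 k) in h5 *.
set q := t * 2 ^+ k in h5 *.
have qE : t * (2 * 2 ^+ k) = 2 * q by rewrite /q; ring.
rewrite qE in h5.
have tq : t <= q.
  by rewrite /q ler_peMr ?(ltW t0)// exprn_ege1// ler1n.
set s := k%:R in h5 * => h6.
have s0 : 0 <= s by exact: ler0n.
rewrite leNgt; apply/negP => hs.
have etq : eps * t <= eps * q by rewrite ler_pM2l.
have h7 : eps * (s + 1) * g <= eps * (s + 1) * D.
  by apply: ler_wpM2l => //; rewrite mulr_ge0 ?(ltW eps0)// addr_ge0.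
have h8 : 2 * (eps * D) <= (eps * s - sg) * D.
  have : 0 <= (eps * s - sg - 2 * eps) * D by rewrite mulr_ge0//; lra.
  lra.
lra.
Qed.

(** The approximation u is a polynomial version of the inf-convolution
    min (M, min over y in Y of f y + psi (D (x, y))), where D is the gauge
    generated by F and Y is a finite subset of K. Both extrema range over finite
    sets of members of the algebra, so soft_max and soft_min apply, and
    envelope_slope bounds the slopes of the pieces that matter at points of K. The
    constant M keeps u bounded away from K. *)
Lemma envelope_approx : exists2 u, A u & [/\
  forall x, `|u x| <= M + eps,
  forall x, K x -> `|u x - f x| <= eps,
  forall x, K x -> lip_near d u x (sigma x + 4 * eps) &
  forall x, lip_near d u x (L + 4 * eps)].
Proof.
have [r r0 hr] := local_scale.
(* The largest slope eps N exceeds L by eps, which forces D to be small. *)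
pose N := (Num.truncn (L / eps)).+2.
have /andP[N1 N2] : L + eps <= eps * N%:R <= L + 2 * eps.
  have h0 : 0 <= L / eps by rewrite divr_ge0 ?ltW.
  have := truncn_le (L / eps); have := truncnS_gt (L / eps).
  rewrite h0 -(ltr_pM2l eps0) -(ler_pM2l eps0) (mulrC eps (L / eps)).
  rewrite divfK ?gt_eqF// /N -(natr1 (Num.truncn _).+1) -(natr1 (Num.truncn _)).
  set m := _%:R => h1 h2; apply/andP; split; lra.
pose t := Num.min r 1 / 8 / 2 ^+ N.
have p2 : 0 < 2 ^+ N :> R by exact: exprn_gt0.
have t0 : 0 < t by rewrite /t !divr_gt0// lt_min r0 ltr01.
have tE : t * 2 ^+ N = Num.min r 1 / 8 by rewrite /t divfK// gt_eqF.
set T2 := t * 2 ^+ N in tE.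
have T2r : T2 <= r / 8 by rewrite tE ler_pM2r// ge_min lexx.
have T21 : T2 <= 1 / 8 by rewrite tE ler_pM2r// ge_min lexx orbT.
have tT : t <= T2 by rewrite /T2 ler_peMr ?(ltW t0)// exprn_ege1// ler1n.
pose theta := eps * t / 16.
have th0 : 0 < theta by rewrite divr_gt0// mulr_gt0.
have thE : 16 * theta = eps * t by rewrite /theta; field.
have eT : eps * T2 <= eps / 8.
  have : eps * T2 <= eps * (1 / 8) by rewrite ler_pM2l.
  lra.
have et : eps * t <= eps * T2 by rewrite ler_pM2l.
have T2E : T2 = t * 2 ^+ N by [].
have N0 : (0 < N)%N by [].
have t2 : 0 < t / 2 by rewrite divr_gt0.
clearbody theta T2 t N.
have [F [F0 FA1 F1 F2]] := finite_gauge r theta r0 th0 hr.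
have FA g : g \in F -> A g by move=> /FA1[].
pose a (y : X) (k : nat) (g : X -> R) (x : X) :=
  f y - eps * (t * 2 ^+ k) + eps * k%:R * (g x - g y).
have aA y k g : g \in F -> A (a y k g).
  move=> /FA Ag; have [_ hD _ hZ] := algA.
  apply: (hD); first exact: algebra_cst.
  by apply: hZ; apply: (hD) => //; exact: algebra_cst.
have a_lip y k g x : g \in F -> lip_near d (a y k g) x (eps * k%:R).
  move=> /FA1[_ hg]; apply: lip_near_lip_on => y' z' _ _.
  have -> : a y k g y' - a y k g z' = eps * k%:R * (g y' - g z') by rewrite /a; ring.
  have ek : 0 <= eps * k%:R by rewrite mulr_ge0// ltW.
  rewrite normrM (ger0_norm ek) EFinM; apply: lee_wpmul2l; first by rewrite lee_fin.
  by have := hg y' z' I I; rewrite mul1e.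
(* The affine pieces whose maximum is f y + psi (D (x, y)). *)
pose T y := [seq a y k g | k <- iota 0 N.+1, g <- F].
have inT y k g : (k <= N)%N -> g \in F -> a y k g \in T y.
  move=> kN gF; have kI : k \in iota 0 N.+1 by rewrite mem_iota.
  exact: (allpairs_f (a y) kI gF).
have Tin y w : w \in T y -> exists k g, [/\ (k <= N)%N, g \in F & w = a y k g].
  by move=> /allpairsP[[k g] [+ gF ->]]; rewrite mem_iota => kN; exists k, g.
have /choice[v hv] : forall y, exists v, A v /\ forall x,
    [/\ forall w, w \in T y -> w x <= v x + theta,
        exists2 w, w \in T y & v x <= w x + theta &
        forall c, 0 <= c ->
          (forall w, w \in T y -> v x - theta <= w x -> lip_near d w x c) ->
          lip_near d v x (c + theta)].
  move=> y; have [||v Av hv] := soft_max d d_ge0 A algA lipA (T y) theta th0.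
  - by move=> Ty; have := inT y 0%N _ (leq0n N) F0; rewrite Ty.
  - by move=> w /Tin[k [g [_ gF ->]]]; exact: aA.
  - by exists v.
have [Y YK hY] : exists2 Y : seq X, (forall y, y \in Y -> K y) &
    forall x, K x -> exists2 y, y \in Y & forall k g, (k <= N)%N -> g \in F ->
      a y k g x <= f x.
  (* Near x the candidate y = x works, since psi 0 = - eps t is negative. *)
  apply: compact_finite_choice => // x Kx; exists x => //.
  have h1 : \forall z \near x, f x - eps * t / 2 < f z.
    apply: near_continuous_gt; first exact: fc.
    by rewrite ltrBlDr ltrDl divr_gt0// mulr_gt0.
  have h2 : \forall z \near x, forall g, g \in F -> - t / (2 * N%:R) < g x - g z.
    apply: near_all_seq => g /FA1 /A1_continuous gc.
    apply: near_continuous_gt.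
      by apply: continuousB; [exact: cst_continuous|exact: gc].
    by rewrite subrr mulNr oppr_lt0 divr_gt0// mulr_gt0// ltr0n.
  apply: filterS2 h1 h2 => z h1 h2 _ k g kN gF.
  have tk : eps * t <= eps * (t * 2 ^+ k).
    by rewrite ler_pM2l// ler_peMr ?(ltW t0)// exprn_ege1// ler1n.
  have : eps * k%:R * (g z - g x) <= eps * (t / 2).
    rewrite -mulrA ler_pM2l//.
    apply: (@le_trans _ _ (k%:R * (t / (2 * N%:R)))).
      by apply: ler_wpM2l => //; have := h2 g gF; rewrite mulNr; lra.
    have -> : k%:R * (t / (2 * N%:R)) = t / 2 * (k%:R / N%:R).
      by rewrite invfM mulrCA !mulrA; congr (_ * _); rewrite mulrAC.
    by rewrite (ger_pMr _ t2) ler_pdivrMr ?ltr0n// mul1r ler_nat.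
  by rewrite /a; lra.
pose us := cst M :: map v Y.
have usA w : w \in us -> A w.
  rewrite inE => /orP[/eqP ->|/mapP[y _ ->]]; first exact: algebra_cst.
  by have [] := hv y.
have [//|u Au hu] := soft_min d d_ge0 A algA lipA us theta th0 _ usA.
have usM : cst M \in us by exact: mem_head.
have v_lip y x c : 0 <= c ->
    (forall k g, (k <= N)%N -> g \in F -> v y x - theta <= a y k g x ->
      eps * k%:R <= c) -> lip_near d (v y) x (c + theta).
  move=> c0 h; have [_ /(_ x)[_ _ h3]] := hv y; apply: h3 => //.
  move=> w /Tin[k [g [kN gF ->]]] hw.
  by apply: lip_nearW (a_lip y k g x gF) => //; exact: h hw.
exists u => //; split.
- move=> x; have [h1 [w wus hw] _] := hu x.
  have := h1 _ usM; rewrite /= ler_norml => h2; apply/andP; split; last by lra.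
  have := fM x; rewrite ler_norml => /andP[_ fxM].
  move: wus hw; rewrite inE => /orP[/eqP -> /=|/mapP[y _ ->] hw].
    by have := normr_ge0 (f x); have := fM x; lra.
  have [_ /(_ x)[h3 _ _]] := hv y.
  have := h3 _ (inT y 0%N _ (leq0n N) F0); rewrite /a /= mulr0 mul0r expr0.
  by have := fM y; rewrite ler_norml; lra.
- move=> x Kx; have [h1 [w wus hw] _] := hu x.
  have [y0 y0Y hy0] := hY x Kx.
  have [_ /(_ x)[_ [w0 /Tin[k [g [kN gF ->]]] h4] _]] := hv y0.
  have := h1 (v y0); rewrite inE map_f ?orbT// => /(_ isT) h5.
  have h6 := hy0 k g kN gF.
  rewrite ler_norml; apply/andP; split; last by lra.
  move: wus hw; rewrite inE => /orP[/eqP -> /=|/mapP[y yY ->] hw].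
    by have := fM x; rewrite ler_norml; lra.
  have [_ /(_ x)[h7 _ _]] := hv y.
  have [g' g'F h8] := F1 x y Kx (YK _ yY).
  have Fnil : F <> [::] by move=> FE; rewrite FE in F0.
  have [g1 g1F hg1] := seq_argmax R _ F (fun g => g x - g y) Fnil.
  have := h7 _ (inT y N g1 (leqnn N) g1F); rewrite /a -T2E.
  have := hg1 _ F0; rewrite /= subrr; set D := g1 x - g1 y => D0.
  have : L * (g' x - g' y) <= L * D by rewrite ler_pM2l// hg1.
  have : (L + eps) * D <= eps * N%:R * D by exact: ler_wpM2r.
  have : 0 <= eps * D by rewrite mulr_ge0// ltW.
  by rewrite mulrDl; lra.
- move=> x Kx; have sx := sigma0 x Kx.
  apply: (@lip_nearW _ _ d d_ge0 _ _ (sigma x + 3 * eps + theta + theta)); first by lra.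
  have [h1 _ h2] := hu x; apply: h2; first by lra.
  move=> w; rewrite inE => /orP[/eqP ->|/mapP[y yY ->]] hw.
    apply: (@lip_nearW _ _ d d_ge0 _ _ 0); first by lra.
    by apply: lip_near_lip_on; exact: lip_on_cst.
  apply: v_lip; first by lra.
  move=> k g kN gF act.
  have Ky := YK _ yY.
  have [y0 y0Y hy0] := hY x Kx.
  have [_ /(_ x)[_ [w0 /Tin[k0 [g0 [k0N g0F ->]]] h4] _]] := hv y0.
  have := h1 (v y0); rewrite inE map_f ?orbT// => /(_ isT) h5.
  have h6 := hy0 k0 g0 k0N g0F.
  have Fnil : F <> [::] by move=> FE; rewrite FE in F0.
  have [g1 g1F hg1] := seq_argmax R _ F (fun g => g x - g y) Fnil.
  have D0 : 0 <= g1 x - g1 y by have := hg1 _ F0; rewrite /= subrr.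
  have [g' g'F h8] := F1 x y Kx Ky.
  have [g'' g''F h9] := F2 x y Kx Ky.
  have [_ /(_ x)[h7 _ _]] := hv y.
  apply: (envelope_slope k N t theta (g1 x - g1 y) T2 (f x) (f y) (sigma x)
    (v y x) r (g x - g y)) => //; last first.
  - by move=> j jN; exact: (h7 _ (inT y j g1 jN g1F)).
  - by lra.
  - move=> Dr; case: h9 => h9; first by have := hg1 _ g''F; lra.
    apply: le_trans h9 _; rewrite lerD2r ler_pM2l// ge_max D0.
    exact: hg1.
  - apply: le_trans h8 _; rewrite lerD2r ler_pM2l//; exact: hg1.
  - exact: hg1.
  - by lra.
- move=> x.
  apply: (@lip_nearW _ _ d d_ge0 _ _ (L + 2 * eps + theta + theta)); first by lra.
  have Le0 : 0 <= L + 2 * eps by rewrite addr_ge0 ?mulr_ge0// ltW.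
  have [_ _ h2] := hu x; apply: h2; first by rewrite addr_ge0// ltW.
  move=> w; rewrite inE => /orP[/eqP ->|/mapP[y yY ->]] hw.
    apply: (@lip_nearW _ _ d d_ge0 _ _ 0); first by rewrite addr_ge0// ltW.
    by apply: lip_near_lip_on; exact: lip_on_cst.
  apply: v_lip => //.
  move=> k g kN _ _; apply: le_trans N2.
  by rewrite ler_pM2l// ler_nat.
Qed.

End Construction.

(** * Borel measurability and inner regularity *)

Section BorelMeasurability.
Context {R : realType} {X : ptopologicalType}.

Lemma open_borel (U : set X) : open U -> measurable (U : set (borel X)).
Proof. by move=> oU; exact: sub_sigma_algebra. Qed.

Lemma closed_borel (U : set X) : closed U -> measurable (U : set (borel X)).
Proof.
move=> cU; rewrite -(setCK U); apply: measurableC.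
by apply: open_borel; exact: closed_openC.
Qed.

(** Both continuous functions and asymptotic Lipschitz constants are covered. *)
Lemma usc_measurable (h : X -> \bar R) :
  (forall y : \bar R, open [set x | (h x < y)%E]) ->
  measurable_fun [set: borel X] h.
Proof.
move=> oh; apply: (measurability _ (ErealGenInftyO.measurableE R)) => _ [_ [r ->] <-].
rewrite setTI; apply: open_borel.
by rewrite (_ : _ @^-1` _ = [set x | (h x < r%:E)%E]).
Qed.

Lemma asymptotic_lip_measurable (d : X -> X -> \bar R) (f : X -> R) :
  measurable_fun [set: borel X] (asymptotic_lip d f).
Proof. by apply: usc_measurable => y; exact: open_asymptotic_lip_lt. Qed.

Lemma continuous_borel_measurable (f : X -> R) : continuous f ->
  measurable_fun [set: borel X] f.
Proof.
move=> fc; apply/measurable_EFinP; apply: usc_measurable => -[r| |].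
- have /continuousP := fc => /(_ [set s | s < r] (@open_lt R r)).
  by congr open; apply/seteqP; split => x /=; rewrite lte_fin.
- rewrite (_ : [set _ | _] = setT); first exact: openT.
  by apply/seteqP; split => x //= _; rewrite ltry.
- rewrite (_ : [set _ | _] = set0); first exact: open0.
  by apply/seteqP; split => x.
Qed.

End BorelMeasurability.

Section Lusin.
Context {R : realType} {X : ptopologicalType}.
Context (m : {finite_measure set (borel X) -> \bar R}).
Context (Xhaus : hausdorff_space X).
Context (mR : radon m).

Lemma compact_borel (K : set X) : compact K -> measurable (K : set (borel X)).
Proof. by move=> cK; apply: closed_borel; exact: compact_closed. Qed.

Lemma measure_lty (B : set (borel X)) : measurable B -> (m B < +oo)%E.
Proof.
move=> mB; apply: (@le_lt_trans _ _ (m setT)).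
  by apply: le_measure; rewrite ?inE.
by rewrite ltey_eq fin_num_measure.
Qed.

Lemma radon_inner (B : set (borel X)) (kappa : R) : measurable B -> 0 < kappa ->
  exists K : set X, [/\ compact K, K `<=` B & (m (B `\` K) <= kappa%:E)%E].
Proof.
move=> mB k0.
have Bfin : m B \is a fin_num by exact: fin_num_measure.
have : (m B - kappa%:E < m B)%E by rewrite lteBlDr// lteDl// lte_fin.
rewrite [X in (_ < X)%E](mR B mB) => /ereal_sup_gt[_ [K [cK KB] <-]] h.
exists K; split => //.
have mK := compact_borel _ cK.
rewrite measureD ?measure_lty// setIidr// leeBlDr ?fin_num_measure//.
by rewrite -leeBlDl// ltW.
Qed.

Lemma bigcup_compact (T : topologicalType) (n : nat) (F : nat -> set T) :
  (forall i, compact (F i)) -> compact (\bigcup_(i < n) F i).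
Proof.
move=> cF; rewrite bigcup_mkord; elim: n => [|n IH].
  by rewrite big_ord0; exact: compact0.
by rewrite big_ord_recr; exact: compactU.
Qed.

(** The function sigma rounds h up to the next multiple of eps, and K is a union of
    compact subsets of the finitely many level sets of sigma. These are disjoint and
    closed, so within K only levels at least n occur near a point of level n:
    upper semicontinuity of h is traded for lower semicontinuity of sigma on
    K. *)
Lemma lusin_usc (h : X -> \bar R) (L eps kappa : R) :
  (forall y : \bar R, open [set x | (h x < y)%E]) ->
  (forall x, 0 <= h x)%E -> (forall x, h x <= L%:E)%E ->
  0 < eps -> 0 < kappa ->
  exists K : set X, exists sigma : X -> R, [/\ compact K,
    (m (~` K) <= kappa%:E)%E,
    forall x, 0 < sigma x,
    forall x, (h x < (sigma x)%:E <= h x + eps%:E)%E &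
    forall x, K x -> \forall x' \near x, K x' -> sigma x <= sigma x'].
Proof.
move=> oh h0 hL eps0 kappa0.
have hE x : h x = (fine (h x))%:E.
  by rewrite fineK// ge0_fin_numE// (le_lt_trans (hL x))// ltry.
have a0 x : 0 <= fine (h x) by exact: fine_ge0.
have aL x : fine (h x) <= L by rewrite -lee_fin -hE.
pose lev x := Num.truncn (fine (h x) / eps).
have levP x : (((lev x)%:R * eps)%:E <= h x < ((lev x).+1%:R * eps)%:E)%E.
  rewrite hE lee_fin lte_fin -ler_pdivlMr// -ltr_pdivrMr//.
  by rewrite truncn_le// truncnS_gt divr_ge0// ltW.
have levlt x n : (h x < (n%:R * eps)%:E)%E = (lev x < n)%N.
  rewrite hE lte_fin -ltr_pdivrMr// /lev ltnNge.
  by rewrite truncn_ge_nat ?ltNge// divr_ge0// ltW.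
pose C n : set (borel X) := [set x | lev x = n].
have mC n : measurable (C n).
  rewrite (_ : C n = [set x | (h x < (n.+1%:R * eps)%:E)%E] `\`
                     [set x | (h x < (n%:R * eps)%:E)%E]).
    by apply: measurableD; apply: open_borel; exact: oh.
  apply/seteqP; split => x; rewrite /C /= !levlt ltnS.
    by move=> ->; rewrite leqnn ltnn.
  by move=> [h1 /negP]; rewrite -leqNgt => h2; apply/eqP; rewrite eqn_leq h1.
pose J := (Num.truncn (L / eps)).+1.
have levJ x : (lev x < J)%N.
  by rewrite ltnS /lev le_truncn// ler_pM2r ?invr_gt0.
have J0 : 0 < J%:R :> R by rewrite ltr0n.
have /choice[Kn hKn] : forall n, exists K : set X,
    [/\ compact K, K `<=` C n & (m (C n `\` K) <= (kappa / J%:R)%:E)%E].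
  by move=> n; apply: radon_inner => //; rewrite divr_gt0.
have cKn n : compact (Kn n) by have [] := hKn n.
have lev_Kn n x : Kn n x -> lev x = n by have [_ h1 _] := hKn n => /h1.
exists (\bigcup_(i < J) Kn i), (fun x => (lev x).+1%:R * eps); split.
- exact: bigcup_compact.
- have mD n : measurable (C n `\` Kn n : set (borel X)).
    by apply: measurableD => //; exact: compact_borel.
  apply: (@le_trans _ _ (m (\big[setU/set0]_(i < J) (C i `\` Kn i)))).
    apply: le_measure; rewrite ?inE.
    - apply: measurableC; apply: compact_borel; exact: bigcup_compact.
    - by apply: bigsetU_measurable.
    - rewrite -(bigcup_mkord J (fun i => C i `\` Kn i)) => x /= hx; exists (lev x); first exact: levJ.
      by split => // hk; apply: hx; exists (lev x) => //; exact: levJ.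
  apply: (le_trans (@Boole_inequality _ _ _ m _ J (fun i _ => mD i))).
  apply: (@le_trans _ _ (\sum_(i < J) (kappa / J%:R)%:E)%E).
    by apply: lee_sum => i _; have [] := hKn i.
  by rewrite sumEFin sumr_const card_ord -[X in X%:E]mulr_natr divfK// gt_eqF.
- by move=> x; rewrite mulr_gt0.
- move=> x; have /andP[h1 h2] := levP x; rewrite h2/=.
  by rewrite -natr1 mulrDl mul1r EFinD leeD2r.
- move=> x [n nJ Knx].
  have cl : closed (\bigcup_(i < n) Kn i).
    by apply: compact_closed => //; exact: bigcup_compact.
  have op := closed_openC cl.
  have nx : (~` \bigcup_(i < n) Kn i) x.
    move=> [i /= ni Kix]; have := ni.
    by rewrite -(lev_Kn _ _ Knx) (lev_Kn _ _ Kix) ltnn.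
  apply: filterS (open_nbhs_nbhs (conj op nx)) => x' /= hx' [i iJ Kix'].
  rewrite ler_pM2r// ler_nat ltnS (lev_Kn _ _ Knx) (lev_Kn _ _ Kix').
  by rewrite leqNgt; apply/negP => ni; apply: hx'; exists i.
Qed.

End Lusin.

(** * Density in energy *)

(** Convexity along a + s = (1 - s) a + s (a + 1). *)
Lemma powR_shift (R : realType) (p a s L : R) : 1 <= p -> 0 <= a <= L ->
  0 <= s <= 1 -> (a + s) `^ p <= a `^ p + s * (L + 1) `^ p.
Proof.
move=> p1 /andP[a0 aL] /andP[s0 s1].
have p0 : 0 <= p by lra.
have /= := @convex_powR R p p1 (Itv01 s0 s1) (a + 1) a.
rewrite !inE /= !in_itv /= !andbT addr_ge0// a0 => /(_ isT isT).
move=> cvx; rewrite convRE [X in X `^ _ <= _]convRE /= /unstable.onem in cvx.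
move: cvx; have -> : s * (a + 1) + (1 - s) * a = a + s by ring.
move=> /le_trans; apply.
have h1 : (a + 1) `^ p <= (L + 1) `^ p.
  by apply: ge0_ler_powR; rewrite ?nnegrE ?lerD2r// addr_ge0// (le_trans a0).
have h2 := powR_ge0 a p.
have : s * (a + 1) `^ p <= s * (L + 1) `^ p by exact: ler_wpM2l.
nra.
Qed.

Section Integral.
Context {R : realType} {X : ptopologicalType}.
Context (m : {finite_measure set (borel X) -> \bar R}).

Lemma integral_le_indic (g h : borel X -> \bar R) (B : set (borel X)) (c1 c2 : R) :
  measurable B -> measurable_fun setT g -> measurable_fun setT h ->
  (forall x, 0 <= g x)%E -> (forall x, 0 <= h x)%E -> 0 <= c1 -> 0 <= c2 ->
  (forall x, g x <= h x + (c1 + c2 * \1_B x)%:E)%E ->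
  (\int[m]_x g x <= \int[m]_x h x + c1%:E * m setT + c2%:E * m B)%E.
Proof.
move=> mB mg mh g0 h0 c10 c20 gh.
have mc1 : measurable_fun setT (cst c1%:E : borel X -> \bar R) by exact: measurable_cst.
have m1 : measurable_fun setT (EFin \o (\1_B : borel X -> R)).
  by apply/measurable_EFinP; exact: measurable_indic.
have mB2 : measurable_fun setT (fun x : borel X => c2%:E * (\1_B x)%:E)%E.
  exact: measurable_funeM.
have c2B (x : borel X) : (0 <= c2%:E * (\1_B x : R)%:E)%E.
  by rewrite -EFinM lee_fin mulr_ge0.
apply: (@le_trans _ _ (\int[m]_x ((h x + cst c1%:E x) + c2%:E * (\1_B x)%:E))%E).
  apply: ge0_le_integral => //.
    by apply: emeasurable_funD => //; exact: emeasurable_funD.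
  by move=> x _; apply: le_trans (gh x) _; rewrite EFinD EFinM addeA.
rewrite ge0_integralD//; last 2 first.
- by move=> x _; rewrite adde_ge0// lee_fin.
- exact: emeasurable_funD.
rewrite ge0_integralD// integral_cst//.
rewrite ge0_integralZl_EFin//.
by rewrite integral_indic// setIT.
Qed.

End Integral.

Section EnergyDensity.
Context {R : realType} {X : ptopologicalType}.
Context (p : R) (d : X -> X -> \bar R).
Context (m : {finite_measure set (borel X) -> \bar R}).
Context (p1 : 1 < p).
Context (hX : emtm_space d m).
Context (A : set (X -> R)).
Context (hA : compatible_algebra d A).

(** Members of the algebra are dense in energy: envelope_approx is applied on a
    compact set of almost full measure, while off this set the bounds on u and its
    Lipschitz constant depend only on f. *)
Lemma energy_density (f : X -> R) (delta : R) : Lipb d f -> 0 < delta ->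
  exists u, [/\ A u,
    (\int[m]_x (`|u x - f x| `^ p)%:E <= delta%:E)%E &
    (\int[m]_x (asymptotic_lip d u x `^ p) <=
     \int[m]_x (asymptotic_lip d f x `^ p) + delta%:E)%E].
Proof.
move=> [fc fb fl] delta0.
have [[Xh dext _ _] mR] := hX.
have [lipA algA recA] := hA.
have d0 x y : (0 <= d x y)%E by have [] := dext.
have p1' : 1 < p := p1.
have p0 : 0 <= p by lra.
have [L L0 fL] := Lip_lty d d0 f _ fl.
have [M M0 fM] : exists2 M : R, 0 < M & forall x, `|f x| <= M.
  move: fb => [M [_ hM]]; exists (`|M| + 1); first by rewrite ltr_wpDl.
  by move=> x; apply: (hM _ _ x I); rewrite (le_lt_trans (ler_norm _))// ltrDl.
pose mX := fine (m setT).
have mXE : m setT = mX%:E by rewrite fineK// fin_num_measure.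
have mX0 : 0 <= mX by exact: fine_ge0.
pose C1 := (L + 1) `^ p; have C10 : 0 <= C1 by exact: powR_ge0.
pose C2 := (L + 4) `^ p; have C20 : 0 <= C2 by exact: powR_ge0.
pose C3 := (2 * M + 1) `^ p; have C30 : 0 <= C3 by exact: powR_ge0.
pose Z := mX + 5 * C1 * mX.
have Z0 : 0 <= Z by rewrite addr_ge0// !mulr_ge0.
pose eps := Num.min (1 / 5) (delta / 2 / (Z + 1)).
have eps0 : 0 < eps by rewrite lt_min; apply/andP; split; rewrite ?divr_gt0// ltr_wpDl.
have eps5 : eps <= 1 / 5 by rewrite ge_min lexx.
have epsZ : eps * Z <= delta / 2.
  apply: (@le_trans _ _ (eps * (Z + 1))); first by rewrite ler_pM2l// lerDl.
  by rewrite -ler_pdivlMr ?ltr_wpDl// ge_min lexx orbT.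
pose kappa := delta / 2 / (C2 + C3 + 1).
have C0 : 0 < C2 + C3 + 1 by rewrite ltr_wpDl// addr_ge0.
have kappa0 : 0 < kappa by rewrite !divr_gt0.
have kappaE : kappa * (C2 + C3 + 1) = delta / 2 by rewrite /kappa divfK// gt_eqF.
have alL x : (asymptotic_lip d f x <= L%:E)%E.
  by apply: asymptotic_lip_le; [exact: ltW|exact: lip_near_lip_on].
have [K [sigma [Kc mK s0 sP slsc]]] := lusin_usc m Xh mR (asymptotic_lip d f) L eps kappa
  (open_asymptotic_lip_lt d f) (asymptotic_lip_ge0 d f) alL eps0 kappa0.
have f_sigma x : K x -> lip_near d f x (sigma x).
  by move=> _; apply: lip_near_asymptotic => //; have /andP[] := sP x.
have [u Au [uM uK u_sigma uL]] := envelope_approx d dext A algA lipA recA f L M eps K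
  sigma fc fM L0 fL eps0 Kc (fun x _ => s0 x) slsc f_sigma.
have mKc : measurable (~` K : set (borel X)).
  by apply: measurableC; exact: compact_borel.
have mKE : m (~` K) = (fine (m (~` K)))%:E by rewrite fineK// fin_num_measure.
have k0 : 0 <= fine (m (~` K)) by exact: fine_ge0.
have kk : fine (m (~` K)) <= kappa by rewrite -lee_fin -mKE.
have e1 : eps <= 1 by lra.
have uc : continuous u by have [] := lipA _ Au.
exists u; split => //.
- have := @integral_le_indic R X m (fun x => (`|u x - f x| `^ p)%:E) (cst 0%E) (~` K) eps C3.
  rewrite integral_cst// mul0e add0e mXE mKE => h.
  apply: le_trans (h _ _ _ _ _ _ _ _) _ => //.
  + apply/measurable_EFinP; apply: (measurableT_comp (measurable_powR p)).
    apply: measurableT_comp => //.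
    by apply: measurable_funB; exact: continuous_borel_measurable.
  + exact: ltW.
  + move=> x /=; rewrite add0e lee_fin indicE.
    have [xK|xK] := pselect (K x).
      rewrite memNset; last by move=> /(_ xK).
      rewrite mulr0 addr0; apply: le_trans (_ : eps `^ p <= _).
        by apply: ge0_ler_powR; rewrite ?nnegrE ?(ltW eps0)//; exact: uK.
      by apply: ge1r_powR; rewrite ?eps0//; lra.
    rewrite mem_set// mulr1; apply: (@le_trans _ _ C3); last by rewrite lerDr ltW.
    apply: ge0_ler_powR; rewrite ?nnegrE//; first by lra.
    apply: le_trans (ler_normB _ _) _; have := uM x; have := fM x; lra.
  + rewrite -!EFinM -EFinD lee_fin.
    have : C3 * fine (m (~` K)) <= C3 * kappa by exact: ler_wpM2l.
    have : 0 <= eps * (5 * C1 * mX) by rewrite !mulr_ge0// ltW.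
    have : 0 <= kappa * C2 by rewrite mulr_ge0// ltW.
    move: epsZ kappaE; rewrite /Z !mulrDr mulr1 (mulrC C3 kappa); lra.
- have := @integral_le_indic R X m (fun x => asymptotic_lip d u x `^ p)%E
    (fun x => asymptotic_lip d f x `^ p)%E (~` K) (5 * eps * C1) C2.
  rewrite mXE mKE => h.
  have malip v : measurable_fun [set: borel X] (fun x => asymptotic_lip d v x `^ p)%E.
    apply: (measurableT_comp (measurable_poweR p)).
    exact: asymptotic_lip_measurable.
  apply: le_trans (h _ _ _ _ _ _ _ _) _ => //.
  + by move=> x; exact: poweR_ge0.
  + by move=> x; exact: poweR_ge0.
  + by rewrite !mulr_ge0// ltW.
  + move=> x.
    have [xK|xK] := pselect (K x).
      rewrite indicE memNset; last by move=> /(_ xK).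
      rewrite mulr0 addr0.
      have al0 := asymptotic_lip_ge0 d f x.
      have fE : asymptotic_lip d f x = (fine (asymptotic_lip d f x))%:E.
        by rewrite fineK// ge0_fin_numE// (le_lt_trans (alL x))// ltry.
      set a := fine _ in fE.
      have a0 : 0 <= a by exact: fine_ge0.
      have aL : a <= L by rewrite -lee_fin -fE.
      have us : (asymptotic_lip d u x <= (a + 5 * eps)%:E)%E.
        have /andP[_ s2] := sP x; rewrite fE -EFinD lee_fin in s2.
        apply: le_trans (asymptotic_lip_le d u x _ _ (u_sigma x xK)) _.
          by rewrite addr_ge0 ?mulr_ge0// ltW.
        by rewrite lee_fin; lra.
      apply: (@le_trans _ _ ((a + 5 * eps)%:E `^ p)%E).
        apply: gt0_ler_poweR => //; rewrite in_itv/= leey andbT.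
          exact: asymptotic_lip_ge0.
        by rewrite lee_fin addr_ge0// mulr_ge0// ltW.
      rewrite fE !poweR_EFin -EFinD lee_fin.
      by apply: powR_shift; lra.
    rewrite indicE mem_set// mulr1.
    apply: (@le_trans _ _ C2%:E).
      rewrite /C2 -poweR_EFin; apply: gt0_ler_poweR => //; rewrite ?in_itv/= ?leey ?andbT.
      + exact: asymptotic_lip_ge0.
      + by rewrite lee_fin; lra.
      + apply: le_trans (asymptotic_lip_le d u x _ _ (uL x)) _; last by rewrite lee_fin; lra.
        by rewrite addr_ge0 ?mulr_ge0// ltW.
    rewrite -[leLHS]add0e; apply: leeD; first exact: poweR_ge0.
    by rewrite lee_fin lerDr !mulr_ge0// ltW.
  + rewrite -addeA leeD2l// -!EFinM -EFinD lee_fin.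
    have : C2 * fine (m (~` K)) <= C2 * kappa by exact: ler_wpM2l.
    have : 0 <= eps * mX by rewrite mulr_ge0// ltW.
    have : 0 <= kappa * C3 by rewrite mulr_ge0// ltW.
    move: epsZ kappaE; rewrite /Z !mulrDr mulr1 (mulrC C2 kappa); lra.
Qed.

End EnergyDensity.

(** * Equality of the Cheeger energies *)

Lemma le_limn_einf (R : realType) (a b : (\bar R)^nat) :
  (forall n, a n <= b n)%E -> (limn_einf a <= limn_einf b)%E.
Proof.
move=> ab; rewrite !limn_einf_lim; apply: lee_lim; [exact: is_cvg_einfs..|].
apply: nearW => n; apply: le_ereal_inf_tmp => _ [k nk <-].
by apply: le_trans (ab k); apply: ereal_inf_lbound; exists k.
Qed.

Section EqualEnergies.
Context {R : realType} {X : ptopologicalType}.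
Context (p : R) (d : X -> X -> \bar R).
Context (m : {finite_measure set (borel X) -> \bar R}).
Context (p1 : 1 < p).
Context (hX : emtm_space d m).

Lemma Lnorm_le_powR (g : X -> R) (tau : R) : 0 <= tau ->
  (\int[m]_x (`|g x| `^ p)%:E <= (tau `^ p)%:E)%E ->
  ('N[m]_(p%:E)[EFin \o g] <= tau%:E)%E.
Proof.
move=> tau0 h; have p1' : 1 < p := p1; rewrite unlock.
apply: (@le_trans _ _ ((tau `^ p)%:E `^ p^-1)%E).
  apply: gt0_ler_poweR; rewrite ?invr_ge0 ?in_itv/= ?leey ?andbT//.
  - by lra.
  - by apply: integral_ge0 => x _; rewrite lee_fin powR_ge0.
  - by rewrite lee_fin powR_ge0.
by rewrite poweR_EFin -powRrM mulfV ?powRr1//; lra.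
Qed.

(** The n-th competitor is replaced by a member of A within 1 / (n + 1) in norm,
    which preserves the limit, and within a fixed e in energy, which shifts the
    limit inferior by at most e. *)
Lemma cheeger_energy_le_Lipb (A : set (X -> R)) (f : X -> R) :
  compatible_algebra d A -> measurable_fun [set: borel X] f ->
  (cheeger_energy d m p A f <= cheeger_energy d m p (Lipb d) f)%E.
Proof.
move=> hA mf; apply: le_ereal_inf_tmp => _ [u [Lu uf] <-].
apply/lee_addgt0Pr => e e0.
have tau0 n : 0 < (n.+1%:R^-1 : R) by rewrite invr_gt0.
have /choice[v hv] : forall n, exists v, [/\ A v,
    (\int[m]_x (`|v x - u n x| `^ p)%:E <= (n.+1%:R^-1 `^ p)%:E)%E &
    (\int[m]_x (asymptotic_lip d v x `^ p) <=
     e%:E + \int[m]_x (asymptotic_lip d (u n) x `^ p))%E].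
  move=> n; have dl0 : 0 < Num.min e (n.+1%:R^-1 `^ p) by rewrite lt_min e0 powR_gt0.
  have [v [Av h1 h2]] := energy_density p d m p1 hX A hA (u n) _ (Lu n) dl0.
  exists v; split => //.
    by apply: le_trans h1 _; rewrite lee_fin ge_min lexx orbT.
  by apply: le_trans h2 _; rewrite addeC leeD2r// lee_fin ge_min lexx.
have [lipA _ _] := hA.
have mA n : measurable_fun [set: borel X] (v n).
  apply: continuous_borel_measurable; have [Avn _ _] := hv n.
  by have [] := lipA _ Avn.
have mU n : measurable_fun [set: borel X] (u n).
  by apply: continuous_borel_measurable; have [] := Lu n.
apply: (@le_trans _ _ (limn_einf (fun n => \int[m]_x (asymptotic_lip d (v n) x `^ p))%E)).
  apply: ereal_inf_lbound; exists v => //; split.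
    by move=> n; have [] := hv n.
  have cvg1 : ((n.+1%:R^-1)%:E + 'N[m]_(p%:E)[EFin \o (u n \- f)%R])%E @[n --> \oo] --> 0%E.
    rewrite -[X in _ --> X]adde0; apply: cvgeD => //.
    by apply: cvg_EFin; [exact: nearW|exact: cvg_harmonic].
  apply: (squeeze_cvge _ (@cvg_cst _ _ _ _ _) cvg1).
  apply: nearW => n; rewrite Lnorm_ge0/=.
  have -> : (v n \- f)%R = ((v n \- u n) \+ (u n \- f))%R.
    by apply/funext => x /=; rewrite addrA subrK.
  apply: le_trans (eminkowski _ _ _ _) _.
  - exact: measurable_funB.
  - exact: measurable_funB.
  - by rewrite lee_fin ltW.
  apply: leeD => //; apply: Lnorm_le_powR; first exact: ltW.
  by have [] := hv n.
rewrite addeC -limn_einf_shift//; apply: le_limn_einf => n.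
by have [] := hv n.
Qed.

Lemma cheeger_energy_compatible (A : set (X -> R)) (f : X -> R) :
  compatible_algebra d A -> measurable_fun [set: borel X] f ->
  cheeger_energy d m p A f = cheeger_energy d m p (Lipb d) f.
Proof.
move=> hA mf; apply/le_anti/andP; split; first exact: cheeger_energy_le_Lipb.
apply: ereal_inf_le_tmp => _ [u [Au uf] <-]; exists u => //; split => // n.
by have [lipA _ _] := hA; apply: lipA; exact: Au.
Qed.

End EqualEnergies.

Theorem theorem12p1 (R : realType) (p : R) (p1 : (1 < p%:E)%E)
    (X : ptopologicalType) (d : X -> X -> \bar R)
    (m : {finite_measure set (borel X) -> \bar R}) (hX : emtm_space d m) :
  (forall A A' : set (X -> R),
      compatible_algebra d A -> compatible_algebra d A' ->
      sobolev_coincide d m (ltW p1) A A') /\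
  (forall A : set (X -> R),
      compatible_algebra d A ->
      sobolev_coincide d m (ltW p1) A (Lipb d)).
Proof.
have p1' : 1 < p by rewrite -lte_fin.
have coincide A A' :
    (forall f : LspaceType m (ltW p1),
      cheeger_energy d m p A f = cheeger_energy d m p A' f) ->
    sobolev_coincide d m (ltW p1) A A'.
  move=> h; split => //; first by apply/funext => f; rewrite /sobolev /= h.
  by move=> f _; rewrite /sobolev_norm h.
have mf (f : LspaceType m (ltW p1)) : measurable_fun [set: borel X] (f : X -> R).
  rewrite /aqEqMfun_to_fun; move: (repr _) => g.
  exact: (@measurable_funP _ _ _ _ setT g).
split => [A A' hA hA'|A hA]; apply: coincide => f.
  by rewrite !cheeger_energy_compatible.
exact: cheeger_energy_compatible.
Qed.
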